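(* Let $I,J\subset\mathbb{R}$ be open intervals with $0\in J$, and let $\alpha: I\times J\to E_1^3$, $(s,t)\mapsto\alpha(s,t)$, be a smooth solution of the vortex filament equation $\alpha_t=\alpha_s\times_L\alpha_{ss}$ such that each curve $\alpha(\cdot,t)$ is a spacelike curve with timelike principal normal and $\|\alpha_s(s,0)\|=1$ for all $s$. Then: (1) There exists a parallel normal frame $(T,E_1,E_2)^T(\cdot,t)$, $T=\alpha_s$, for each spacelike curve $\alpha(\cdot,t)$ with timelike principal normal (depending smoothly on $(s,t)$) such that $$\begin{bmatrix} T \\ E_1 \\ E_2 \end{bmatrix}_s=\begin{bmatrix} 0&k_1&k_2 \\ k_1&0&0 \\ -k_2&0&0 \end{bmatrix}\begin{bmatrix} T \\ E_1 \\ E_2 \end{bmatrix},$$ $$\begin{bmatrix} T \\ E_1 \\ E_2 \end{bmatrix}_t=\begin{bmatrix} 0&(k_2)_s&(k_1)_s \\ (k_2)_s&0&\frac12(k_1^2-k_2^2) \\ -(k_1)_s&\frac12(k_1^2-k_2^2)&0 \end{bmatrix}\begin{bmatrix} T \\ E_1 \\ E_2 \end{bmatrix},$$ where $k_1(\cdot,t)$ and $k_2(\cdot,t)$ are the principal curvatures of $\alpha(\cdot,t)$ along $E_1(\cdot,t)$ and $E_2(\cdot,t)$, respectively. (2) With $k_1,k_2$ as in (1), the pair $$q=\frac{1}{\sqrt2}(k_1+k_2),\qquad r=-\frac{1}{\sqrt2}(k_1-k_2)$$ is a solution of the non-linear heat system $$q_t=q_{ss}+q^2r,\qquad r_t=-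r_{ss}-r^2q.$$
   Context: Minkowski 3-space $E_1^3$ is $\mathbb{R}^3$ with the Lorentzian inner product $\langle x,y\rangle_L=-x_1y_1+x_2y_2+x_3y_3$. The norm is $\|x\|=\sqrt{|\langle x,x\rangle_L|}$. The Lorentzian vector product is $x\times_L y=(-x_2y_3+x_3y_2,\;x_3y_1-x_1y_3,\;x_1y_2-x_2y_1)$. A vector $x$ is spacelike, lightlike or timelike if $\langle x,x\rangle_L$ is $>0$, $=0$, $<0$ respectively; a curve is spacelike if all of its tangent vectors are spacelike. Subscripts $s$ and $t$ denote partial derivatives. For a solution of the vortex filament equation with $\|\alpha_s(s,0)\|=1$ for all $s$, one has $\|\alpha_s(s,t)\|=1$ for all $(s,t)$ (known fact), so $s$ is an arclength parameter for each $\alpha(\cdot,t)$ and $T=\alpha_s$ is the unit tangent. The principal normal $N$ is the unit vector field with $T_s=\kappa N$, $\kappa$ being the curvature; ''timelike principal normal'' means $\langle N,N\rangle_L=-1$ (so $T_s$ is everywhere timelike), and the binormal $B=T\times_L N$ is then spacelike. A parallel (normal) frame of a unit speed spacelike curve with timelike principal normal and unit tangent $T$ is an orthonormal frame $(T,E_1,E_2)$ along the curve with $\langle T,T\rangle_L=1$, $\langle E_1,E_1\rangle_L=-1$, $\langle E_2,E_2\rangle_L=1$, all mutual products zero, and $\langle (E_1)_s,E_2\rangle_L=\langle E_1,(E_2)_s\rangle_L=0$. The principal curvatures $k_1,k_2$ of the curve along $E_1,E_2$ are the coefficients in $T_s=k_1E_1+k_2E_2$. *)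

(* Defs.v *)
From Stdlib Require Import Reals.
From Coquelicot Require Import Coquelicot.
Open Scope R_scope.

Definition E13 : Type := (R * R * R)%type.

Definition x1 (x : E13) : R := fst (fst x).
Definition x2 (x : E13) : R := snd (fst x).
Definition x3 (x : E13) : R := snd x.

Definition lprod (x y : E13) : R :=
  - (x1 x * x1 y) + x2 x * x2 y + x3 x * x3 y.

Definition lnorm (x : E13) : R := sqrt (Rabs (lprod x x)).

Definition lcross (x y : E13) : E13 :=
  (- (x2 x * x3 y) + x3 x * x2 y,
   x3 x * x1 y - x1 x * x3 y,
   x1 x * x2 y - x2 x * x1 y).

Definition spacelike (x : E13) : Prop := 0 < lprod x x.

(** The row [(a, b, c)] times the column [(u, v, w)] of vectors. *)
Definition lincomb (a b c : R) (u v w : E13) : E13 :=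
  plus (plus (scal a u) (scal b v)) (scal c w).

Definition vderive (g : R -> E13) (s : R) : E13 :=
  (Derive (fun u => x1 (g u)) s,
   Derive (fun u => x2 (g u)) s,
   Derive (fun u => x3 (g u)) s).

(** Partial derivatives; the first variable is [s], the second is [t]. *)
Definition Ds (F : R -> R -> E13) (s t : R) : E13 := vderive (fun u => F u t) s.
Definition Dt (F : R -> R -> E13) (s t : R) : E13 := vderive (fun u => F s u) t.
Definition ds (f : R -> R -> R) (s t : R) : R := Derive (fun u => f u t) s.
Definition dt (f : R -> R -> R) (s t : R) : R := Derive (fun u => f s u) t.

Definition is_open_interval (I : R -> Prop) : Prop :=
  exists a b : Rbar, forall x : R, I x <-> Rbar_lt a x /\ Rbar_lt x b.

(** [C^infty] on the open set [I x J].  Functions are total on [R x R], but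
    only their values on [I x J] matter: derivatives at its points are local. *)
Definition smooth_on (I J : R -> Prop) (f : R -> R -> R) : Prop :=
  forall (n : nat) (s t : R), I s -> J t -> ex_diff_n f n s t.

Definition vsmooth_on (I J : R -> Prop) (F : R -> R -> E13) : Prop :=
  smooth_on I J (fun s t => x1 (F s t)) /\
  smooth_on I J (fun s t => x2 (F s t)) /\
  smooth_on I J (fun s t => x3 (F s t)).

Definition spacelike_curve (I : R -> Prop) (g : R -> E13) : Prop :=
  forall s, I s -> spacelike (vderive g s).

(** Curvature and principal normal of a curve in its arclength parameter, so
    that the unit tangent is [vderive g]. *)
Definition curvature (g : R -> E13) (s : R) : R :=
  lnorm (vderive (vderive g) s).

Definition principal_normal (g : R -> E13) (s : R) : E13 :=
  scal (/ curvature g s) (vderive (vderive g) s).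

Definition timelike_principal_normal (I : R -> Prop) (g : R -> E13) : Prop :=
  forall s, I s ->
    curvature g s <> 0 /\
    lprod (principal_normal g s) (principal_normal g s) = -1.

Definition parallel_frame (I : R -> Prop) (g E1 E2 : R -> E13) : Prop :=
  forall s, I s ->
    let T := vderive g in
    lprod (T s) (T s) = 1 /\
    lprod (E1 s) (E1 s) = -1 /\
    lprod (E2 s) (E2 s) = 1 /\
    lprod (T s) (E1 s) = 0 /\
    lprod (T s) (E2 s) = 0 /\
    lprod (E1 s) (E2 s) = 0 /\
    lprod (vderive E1 s) (E2 s) = 0 /\
    lprod (E1 s) (vderive E2 s) = 0.

Definition principal_curvatures (I : R -> Prop) (g E1 E2 : R -> E13)
    (k1 k2 : R -> R) : Prop :=
  forall s, I s ->
    vderive (vderive g) s = plus (scal (k1 s) (E1 s)) (scal (k2 s) (E2 s)).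

Definition vortex_filament (I J : R -> Prop) (alpha : R -> R -> E13) : Prop :=
  forall s t, I s -> J t ->
    Dt alpha s t = lcross (Ds alpha s t) (Ds (Ds alpha) s t).

Definition frame_eqs_s (I J : R -> Prop) (T E1 E2 : R -> R -> E13)
    (k1 k2 : R -> R -> R) : Prop :=
  forall s t, I s -> J t ->
    let row a b c := lincomb a b c (T s t) (E1 s t) (E2 s t) in
    Ds T s t  = row 0            (k1 s t) (k2 s t) /\
    Ds E1 s t = row (k1 s t)     0        0 /\
    Ds E2 s t = row (- k2 s t)   0        0.

Definition frame_eqs_t (I J : R -> Prop) (T E1 E2 : R -> R -> E13)
    (k1 k2 : R -> R -> R) : Prop :=
  forall s t, I s -> J t ->
    let row a b c := lincomb a b c (T s t) (E1 s t) (E2 s t) in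
    let w := 1 / 2 * (k1 s t ^ 2 - k2 s t ^ 2) in
    Dt T s t  = row 0              (ds k2 s t) (ds k1 s t) /\
    Dt E1 s t = row (ds k2 s t)    0           w /\
    Dt E2 s t = row (- ds k1 s t)  w           0.

Definition vortex_parallel_frame (I J : R -> Prop) (alpha : R -> R -> E13)
    (E1 E2 : R -> R -> E13) (k1 k2 : R -> R -> R) : Prop :=
  vsmooth_on I J E1 /\ vsmooth_on I J E2 /\
  smooth_on I J k1 /\ smooth_on I J k2 /\
  (forall t, J t ->
     parallel_frame I (fun s => alpha s t) (fun s => E1 s t) (fun s => E2 s t) /\
     principal_curvatures I (fun s => alpha s t)
       (fun s => E1 s t) (fun s => E2 s t) (fun s => k1 s t) (fun s => k2 s t)) /\
  frame_eqs_s I J (Ds alpha) E1 E2 k1 k2 /\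
  frame_eqs_t I J (Ds alpha) E1 E2 k1 k2.

Definition nonlinear_heat_system (I J : R -> Prop) (q r : R -> R -> R) : Prop :=
  smooth_on I J q /\ smooth_on I J r /\
  forall s t, I s -> J t ->
    dt q s t = ds (ds q) s t + q s t ^ 2 * r s t /\
    dt r s t = - ds (ds r) s t - r s t ^ 2 * q s t.

(* Main.v *)
Require Import Defs.
From Stdlib Require Import Reals Lra Classical.
From Coquelicot Require Import Coquelicot.
Open Scope R_scope.

(** Differentiating the filament equation in [s] gives [T_t = lcross T T_ss].
    This is orthogonal to [T], so arclength is preserved ([unit_tangent]).

    Let [N], [B = lcross T N] be the Frenet normals, [kap] and [tau] the
    curvature and torsion, and [nu = lprod N_t B] ([frenet_moving_frame]).  Then
    [T_s = kap N] and [T_t = kap tau N + kap_s B].  The two derivatives of a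
    frame commute, which is a zero curvature condition on the two matrices that
    describe its motion ([moving_frame_compatibility]).  For the Frenet frame
    one of its entries is [nu_s - tau_t = kap kap_s].

    Boosting the plane of [N] and [B] by an angle [th] boosts the curvatures and
    adds [th_s], [th_t] to [tau], [nu] ([moving_frame_boost]).  So the wanted
    frame is obtained from an angle with [th_s = - tau] and
    [th_t = kap^2 / 2 - nu], where [kap^2 = k1^2 - k2^2].  The displayed entry of
    the zero curvature condition says that these equations are compatible, and a
    solution exists on the rectangle ([smooth_on_potential]).  The principal
    curvatures are [k1 = kap cosh th] and [k2 = - kap sinh th].

    Conversely, for every parallel frame with the prescribed [t]-evolution, the
    same zero curvature condition reads [k1_t = k2_ss - w k2] and
    [k2_t = k1_ss - w k1] with [w = (k1^2 - k2^2) / 2 = - q r].  Taking sum and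
    difference yields the heat system ([heat_system_of_parallel_frame]). *)

(** * Smooth functions on a rectangle *)

Lemma open_interval_locally (I : R -> Prop) (x : R) :
  is_open_interval I -> I x -> locally x I.
Proof.
intros [a [b H]] Hx; destruct (proj1 (H x) Hx) as [H1 H2].
apply filter_imp with (fun y : R => Rbar_lt a y /\ Rbar_lt y b).
- intros y Hy; now apply H.
- apply filter_and; [exact (open_Rbar_gt' x a H1) | exact (open_Rbar_lt' x b H2)].
Qed.

Lemma open_interval_convex (I : R -> Prop) (a b x : R) :
  is_open_interval I -> I a -> I b -> Rmin a b <= x <= Rmax a b -> I x.
Proof.
intros [l [r H]] Ha Hb [Hx1 Hx2].
apply H in Ha; apply H in Hb; apply H; split.
- apply Rbar_lt_le_trans with (Rmin a b); [|exact Hx1].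
  unfold Rmin; destruct (Rle_dec a b); tauto.
- apply Rbar_le_lt_trans with (Rmax a b); [exact Hx2|].
  unfold Rmax; destruct (Rle_dec a b); tauto.
Qed.

Section Smooth.

Variables I J : R -> Prop.
Hypotheses (hI : is_open_interval I) (hJ : is_open_interval J).

Lemma locally_2d_rectangle (s t : R) : I s -> J t ->
  locally_2d (fun u v => I u /\ J v) s t.
Proof.
intros Hs Ht.
destruct (open_interval_locally I s hI Hs) as [d1 H1].
destruct (open_interval_locally J t hJ Ht) as [d2 H2].
exists (mkposreal _ (Rmin_stable_in_posreal d1 d2)); simpl; intros u v Hu Hv; split.
- apply H1. eapply Rlt_le_trans; [exact Hu | apply Rmin_l].
- apply H2. eapply Rlt_le_trans; [exact Hv | apply Rmin_r].
Qed.

Definition eq_on (f g : R -> R -> R) : Prop :=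
  forall s t, I s -> J t -> f s t = g s t.

Lemma is_derive_ext_s (f g : R -> R -> R) (s t l : R) : eq_on f g -> I s -> J t ->
  is_derive (fun u => f u t) s l -> is_derive (fun u => g u t) s l.
Proof.
intros E Hs Ht; apply is_derive_ext_loc.
apply filter_imp with (2 := open_interval_locally I s hI Hs); intros u Hu; auto.
Qed.

Lemma is_derive_ext_t (f g : R -> R -> R) (s t l : R) : eq_on f g -> I s -> J t ->
  is_derive (fun u => f s u) t l -> is_derive (fun u => g s u) t l.
Proof.
intros E Hs Ht; apply is_derive_ext_loc.
apply filter_imp with (2 := open_interval_locally J t hJ Ht); intros u Hu; auto.
Qed.

Lemma smooth_on_ext (f g : R -> R -> R) :
  eq_on f g -> smooth_on I J f -> smooth_on I J g.
Proof.
intros E Hf n s t Hs Ht; apply ex_diff_n_ext_loc with f; [|now apply Hf].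
destruct (locally_2d_rectangle s t Hs Ht) as [d Hd].
exists d; intros u v Hu Hv; destruct (Hd u v Hu Hv); auto.
Qed.

Lemma smooth_on_ds (f : R -> R -> R) : smooth_on I J f -> smooth_on I J (ds f).
Proof. intros Hf n s t Hs Ht; apply (ex_diff_n_deriv_aux1 f n s t); now apply Hf. Qed.

Lemma smooth_on_dt (f : R -> R -> R) : smooth_on I J f -> smooth_on I J (dt f).
Proof. intros Hf n s t Hs Ht; apply (ex_diff_n_deriv_aux2 f n s t); now apply Hf. Qed.

Lemma smooth_on_continuity (f : R -> R -> R) (s t : R) :
  smooth_on I J f -> I s -> J t -> continuity_2d_pt f s t.
Proof. intros Hf Hs Ht; exact (proj1 (Hf 0%nat s t Hs Ht)). Qed.

Lemma smooth_on_is_derive_s (f : R -> R -> R) (s t : R) :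
  smooth_on I J f -> I s -> J t -> is_derive (fun u => f u t) s (ds f s t).
Proof. intros Hf Hs Ht; apply Derive_correct, (Hf 1%nat s t Hs Ht). Qed.

Lemma smooth_on_is_derive_t (f : R -> R -> R) (s t : R) :
  smooth_on I J f -> I s -> J t -> is_derive (fun u => f s u) t (dt f s t).
Proof. intros Hf Hs Ht; apply Derive_correct, (Hf 1%nat s t Hs Ht). Qed.

Lemma smooth_on_schwarz (f : R -> R -> R) (s t : R) :
  smooth_on I J f -> I s -> J t -> ds (dt f) s t = dt (ds f) s t.
Proof.
intros Hf Hs Ht; apply (Schwarz f s t).
- destruct (locally_2d_rectangle s t Hs Ht) as [d Hd].
  exists d; intros u v Hu Hv; destruct (Hd u v Hu Hv) as [Iu Jv].
  repeat split; try (apply (Hf 1%nat u v Iu Jv)).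
  + apply (smooth_on_dt f Hf 1%nat u v Iu Jv).
  + apply (smooth_on_ds f Hf 1%nat u v Iu Jv).
- apply (smooth_on_continuity (ds (dt f))); auto using smooth_on_ds, smooth_on_dt.
- apply (smooth_on_continuity (dt (ds f))); auto using smooth_on_ds, smooth_on_dt.
Qed.

(** [fs] and [ft] are explicit partial derivatives, so that a class of such
    triples can be checked for closure without computing [Derive]. *)
Definition c1_with (f fs ft : R -> R -> R) : Prop :=
  forall s t, I s -> J t ->
    continuity_2d_pt f s t /\
    is_derive (fun u => f u t) s (fs s t) /\
    is_derive (fun u => f s u) t (ft s t).

Lemma smooth_on_c1_with (f : R -> R -> R) :
  smooth_on I J f -> c1_with f (ds f) (dt f).
Proof.
intros Hf s t Hs Ht; split; [|split].
- now apply smooth_on_continuity.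
- now apply smooth_on_is_derive_s.
- now apply smooth_on_is_derive_t.
Qed.

(** Smoothness is a coinductive property: a class of C^1 functions that
    contains the partial derivatives of its members consists of smooth
    functions, since each order of differentiability follows from the previous
    one applied to the partials.  This replaces the Leibniz and Faa di Bruno
    formulas in all closure properties below. *)
Lemma smooth_on_of_class (P : (R -> R -> R) -> Prop) :
  (forall f, P f -> exists fs ft, P fs /\ P ft /\ c1_with f fs ft) ->
  forall f, P f -> smooth_on I J f.
Proof.
intros HP f Pf n; revert f Pf; induction n as [|n IH]; intros f Pf s t Hs Ht;
  destruct (HP f Pf) as [fs [ft [Ps [Pt Hf]]]]; destruct (Hf s t Hs Ht) as [Hc [Hds Hdt]].
- now split.
- simpl; split; [exact Hc|]; split; [now exists (fs s t)|]; split; [now exists (ft s t)|].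
  destruct (locally_2d_rectangle s t Hs Ht) as [d Hd]; split.
  + apply ex_diff_n_ext_loc with fs; [|now apply IH].
    exists d; intros u v Hu Hv; destruct (Hd u v Hu Hv) as [Iu Jv].
    symmetry; apply is_derive_unique, (Hf u v Iu Jv).
  + apply ex_diff_n_ext_loc with ft; [|now apply IH].
    exists d; intros u v Hu Hv; destruct (Hd u v Hu Hv) as [Iu Jv].
    symmetry; apply is_derive_unique, (Hf u v Iu Jv).
Qed.

Lemma smooth_on_of_c1 (f fs ft : R -> R -> R) :
  c1_with f fs ft -> smooth_on I J fs -> smooth_on I J ft -> smooth_on I J f.
Proof.
intros Hf Hs Ht.
apply smooth_on_of_class with (P := fun g => g = f \/ smooth_on I J g); [|now left].
intros g [->|Hg].
- exists fs, ft; auto.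
- exists (ds g), (dt g); auto using smooth_on_ds, smooth_on_dt, smooth_on_c1_with.
Qed.

(** The class to which the principle above is applied.  It contains the
    derivatives of its own members because those of the exponential, the
    inverse and the square root are again expressions in these functions. *)
Inductive smooth_expr : (R -> R -> R) -> Prop :=
| sx_atom f : smooth_on I J f -> smooth_expr f
| sx_const c : smooth_expr (fun _ _ => c)
| sx_plus f g : smooth_expr f -> smooth_expr g -> smooth_expr (fun s t => f s t + g s t)
| sx_mult f g : smooth_expr f -> smooth_expr g -> smooth_expr (fun s t => f s t * g s t)
| sx_exp f : smooth_expr f -> smooth_expr (fun s t => exp (f s t))
| sx_inv f : (forall s t, I s -> J t -> f s t <> 0) ->
    smooth_expr f -> smooth_expr (fun s t => / f s t)
| sx_sqrt f : (forall s t, I s -> J t -> 0 < f s t) ->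
    smooth_expr f -> smooth_expr (fun s t => sqrt (f s t)).

Lemma smooth_expr_smooth (f : R -> R -> R) : smooth_expr f -> smooth_on I J f.
Proof.
apply smooth_on_of_class; clear f.
intros f Hf; induction Hf as
  [f Hf | c | f g Hf [fs [ft [Pfs [Pft Df]]]] Hg [gs [gt [Pgs [Pgt Dg]]]]
   | f g Hf [fs [ft [Pfs [Pft Df]]]] Hg [gs [gt [Pgs [Pgt Dg]]]]
   | f Hf [fs [ft [Pfs [Pft Df]]]] | f H0 Hf [fs [ft [Pfs [Pft Df]]]]
   | f H0 Hf [fs [ft [Pfs [Pft Df]]]]].
- exists (ds f), (dt f); split; [|split].
  + now apply sx_atom, smooth_on_ds.
  + now apply sx_atom, smooth_on_dt.
  + now apply smooth_on_c1_with.
- exists (fun _ _ => 0), (fun _ _ => 0); split; [|split]; [apply sx_const .. |].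
  intros s t _ _; split; [apply continuity_2d_pt_const|].
  split; apply (is_derive_const c).
- exists (fun s t => fs s t + gs s t), (fun s t => ft s t + gt s t).
  split; [|split]; [apply sx_plus; assumption .. |].
  intros s t Hs Ht; destruct (Df s t Hs Ht) as [? []], (Dg s t Hs Ht) as [? []].
  split; [now apply continuity_2d_pt_plus|].
  split; now apply @is_derive_plus.
- exists (fun s t => fs s t * g s t + f s t * gs s t),
    (fun s t => ft s t * g s t + f s t * gt s t).
  split; [|split]; [apply sx_plus; apply sx_mult; assumption .. |].
  intros s t Hs Ht; destruct (Df s t Hs Ht) as [? []], (Dg s t Hs Ht) as [? []].
  split; [now apply continuity_2d_pt_mult|]; split.
  + now apply (Derive.is_derive_mult (fun u => f u t) (fun u => g u t)).
  + now apply (Derive.is_derive_mult (fun u => f s u) (fun u => g s u)).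
- exists (fun s t => fs s t * exp (f s t)), (fun s t => ft s t * exp (f s t)).
  split; [|split]; [apply sx_mult; [assumption | now apply sx_exp] .. |].
  intros s t Hs Ht; destruct (Df s t Hs Ht) as [? []]; split; [|split].
  + apply continuity_1d_2d_pt_comp; [|assumption].
    apply derivable_continuous_pt, derivable_pt_exp.
  + apply (is_derive_comp exp (fun u => f u t)); [apply is_derive_exp | assumption].
  + apply (is_derive_comp exp (fun u => f s u)); [apply is_derive_exp | assumption].
(* the derivatives are written as products so as to be expressions themselves *)
- exists (fun s t => -1 * fs s t * (/ f s t * / f s t)),
    (fun s t => -1 * ft s t * (/ f s t * / f s t)).
  assert (Hi := sx_inv f H0 Hf).
  split; [|split]; [repeat apply sx_mult; try assumption; apply sx_const .. |].
  intros s t Hs Ht; destruct (Df s t Hs Ht) as [? []]; split; [|split].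
  + apply continuity_2d_pt_inv; auto.
  + replace (-1 * fs s t * (/ f s t * / f s t)) with (- fs s t / f s t ^ 2)
      by (field; auto).
    apply (is_derive_inv (fun u => f u t)); auto.
  + replace (-1 * ft s t * (/ f s t * / f s t)) with (- ft s t / f s t ^ 2)
      by (field; auto).
    apply (is_derive_inv (fun u => f s u)); auto.
- assert (Hp : forall s t, I s -> J t -> 0 < sqrt (f s t))
    by (intros; apply sqrt_lt_R0; auto).
  exists (fun s t => / 2 * fs s t * / sqrt (f s t)),
    (fun s t => / 2 * ft s t * / sqrt (f s t)).
  assert (Hi : smooth_expr (fun s t => / sqrt (f s t))).
  { apply (sx_inv (fun s t => sqrt (f s t))).
    - intros; apply Rgt_not_eq, Hp; auto.
    - now apply sx_sqrt. }
  split; [|split]; [repeat apply sx_mult; try assumption; apply sx_const .. |].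
  intros s t Hs Ht; destruct (Df s t Hs Ht) as [? []].
  assert (Hne : sqrt (f s t) <> 0) by (apply Rgt_not_eq, Hp; auto).
  split; [|split].
  + apply continuity_1d_2d_pt_comp; [|assumption].
    apply continuity_pt_sqrt, Rlt_le; auto.
  + replace (/ 2 * fs s t * / sqrt (f s t)) with (fs s t / (2 * sqrt (f s t)))
      by (field; auto).
    apply (is_derive_sqrt (fun u => f u t)); auto.
  + replace (/ 2 * ft s t * / sqrt (f s t)) with (ft s t / (2 * sqrt (f s t)))
      by (field; auto).
    apply (is_derive_sqrt (fun u => f s u)); auto.
Qed.

(** * Potentials of closed one-forms *)

(** Along the first variable the increment is controlled by the mean value
    theorem, the partial derivative being locally bounded; along the second one
    continuity is assumed. *)
Lemma continuity_2d_pt_of_partials (f fs : R -> R -> R) (s t : R) :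
  locally_2d (fun u v => is_derive (fun z => f z v) u (fs u v)) s t ->
  continuity_2d_pt fs s t -> continuity_pt (fun v => f s v) t ->
  continuity_2d_pt f s t.
Proof.
intros [d0 Hd0] Hc Ht eps.
destruct (Hc (mkposreal 1 Rlt_0_1)) as [d1 Hd1]; simpl in Hd1.
destruct (Ht (eps / 2)) as [d2 [Hd2p Hd2]]; [apply is_pos_div_2|].
(* a bound of [fs] near [(s, t)], by continuity with tolerance 1 *)
set (M := Rabs (fs s t) + 1).
assert (HM : 0 < M) by (unfold M; pose proof (Rabs_pos (fs s t)); lra).
assert (Hd3 : 0 < eps / (2 * M)).
{ apply Rdiv_lt_0_compat; [apply cond_pos | lra]. }
set (d := Rmin (Rmin d0 d1) (Rmin d2 (eps / (2 * M)))).
assert (Hd : 0 < d) by (unfold d; repeat apply Rmin_pos; auto; apply cond_pos).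
exists (mkposreal d Hd); simpl; intros u v Hu Hv.
assert (Hl : forall z, Rabs z < d ->
  Rabs z < d0 /\ Rabs z < d1 /\ Rabs z < d2 /\ Rabs z < eps / (2 * M)).
{ intros z Hz; unfold d in Hz.
  pose proof (Rmin_l (Rmin d0 d1) (Rmin d2 (eps / (2 * M)))).
  pose proof (Rmin_r (Rmin d0 d1) (Rmin d2 (eps / (2 * M)))).
  pose proof (Rmin_l d0 d1); pose proof (Rmin_r d0 d1).
  pose proof (Rmin_l d2 (eps / (2 * M))); pose proof (Rmin_r d2 (eps / (2 * M))).
  lra. }
destruct (Hl _ Hv) as [Hv0 [Hv1 [Hv2 Hv3]]].
assert (Hbt : forall c, Rmin s u <= c <= Rmax s u -> Rabs (c - s) < d).
{ intros c Hcu. revert Hu; unfold Rmin, Rmax in Hcu.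
  destruct (Rle_dec s u); intros Hu; apply Rabs_def2 in Hu; apply Rabs_def1; lra. }
destruct (MVT_gen (fun z => f z v) s u (fun z => fs z v)) as [c [Hc1 Hc2]].
- intros x Hx; apply Hd0; [|assumption]; apply Hl, Hbt; lra.
- intros x Hx; apply continuity_pt_filterlim.
  apply (ex_derive_continuous (fun z => f z v)); exists (fs x v).
  apply Hd0; [|assumption]; apply Hl, Hbt; lra.
- assert (Hfc : Rabs (fs c v) < M).
  { specialize (Hbt c Hc1); apply Hl in Hbt.
    assert (H := Hd1 c v (proj1 (proj2 Hbt)) Hv1).
    unfold M; pose proof (Rabs_triang_inv (fs c v) (fs s t)); lra. }
  replace (f u v - f s t) with ((f u v - f s v) + (f s v - f s t)) by ring.
  eapply Rle_lt_trans; [apply Rabs_triang|].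
  assert (H1 : Rabs (f s v - f s t) < eps / 2).
  { destruct (Req_dec v t) as [->|Hne].
    - rewrite Rminus_diag, Rabs_R0; apply is_pos_div_2.
    - apply (Hd2 v); split; [split; [exact Logic.I | auto] | exact Hv2]. }
  assert (H2 : Rabs (f u v - f s v) <= eps / 2).
  { rewrite Hc2, Rabs_mult.
    apply Rle_trans with (M * (eps / (2 * M))).
    - apply Rmult_le_compat; try apply Rabs_pos; [lra|].
      apply Rlt_le, Hl, Hu.
    - right; field; lra. }
  lra.
Qed.

Lemma continuity_2d_pt_swap (f : R -> R -> R) (x y : R) :
  continuity_2d_pt f x y -> continuity_2d_pt (fun a b => f b a) y x.
Proof.
intros H eps; destruct (H eps) as [d Hd]; exists d; intros u v Hu Hv; now apply Hd.
Qed.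

(** Poincare's lemma on a rectangle: integrate [p ds + h dt] from [(s0, t0)]
    first along [t] at [s0], then along [s].  The integral in [s] is
    differentiated in [t] under the integral sign, where closedness turns the
    integrand into [ds h]. *)
Lemma smooth_on_potential (p h : R -> R -> R) :
  smooth_on I J p -> smooth_on I J h -> eq_on (dt p) (ds h) ->
  exists th, smooth_on I J th /\ c1_with th p h.
Proof.
intros Hp Hh Hclosed.
cut (exists th, c1_with th p h).
{ intros [th Hth]; exists th; split; [now apply smooth_on_of_c1 with p h | exact Hth]. }
destruct (classic (exists s0 t0, I s0 /\ J t0)) as [[s0 [t0 [Is0 Jt0]]] | Hempty].
(* over an empty rectangle any function is a potential *)
2:{ exists p; intros s t Hs Ht; destruct Hempty; now exists s, t. }
assert (contp : forall s t, I s -> J t -> continuous (fun u => p u t) s).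
{ intros s t Hs Ht; apply (ex_derive_continuous (fun u => p u t)).
  exists (ds p s t); now apply smooth_on_is_derive_s. }
assert (conth : forall t, J t -> continuous (fun v => h s0 v) t).
{ intros t Ht; apply (ex_derive_continuous (fun v => h s0 v)).
  exists (dt h s0 t); now apply smooth_on_is_derive_t. }
assert (intp : forall s t, I s -> J t -> ex_RInt (fun u => p u t) s0 s).
{ intros s t Hs Ht; apply (ex_RInt_continuous (V := R_CompleteNormedModule)).
  intros z Hz; apply contp; [|assumption].
  exact (open_interval_convex I s0 s z hI Is0 Hs Hz). }
assert (inth : forall t, J t -> ex_RInt (fun v => h s0 v) t0 t).
{ intros t Ht; apply (ex_RInt_continuous (V := R_CompleteNormedModule)).
  intros z Hz; apply conth.
  exact (open_interval_convex J t0 t z hJ Jt0 Ht Hz). }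
set (P := fun s t => RInt (fun u => p u t) s0 s).
set (H := fun t => RInt (fun v => h s0 v) t0 t).
assert (dPs : forall s t, I s -> J t -> is_derive (fun u => P u t) s (p s t)).
{ intros s t Hs Ht; apply (is_derive_RInt (fun u => p u t) (fun u => P u t) s0 s).
  - apply filter_imp with (2 := open_interval_locally I s hI Hs); intros u Hu.
    apply (RInt_correct (V := R_CompleteNormedModule)), intp; assumption.
  - now apply contp. }
assert (dH : forall t, J t -> is_derive H t (h s0 t)).
{ intros t Ht; apply (is_derive_RInt (fun v => h s0 v) H t0 t).
  - apply filter_imp with (2 := open_interval_locally J t hJ Ht); intros u Hu.
    apply (RInt_correct (V := R_CompleteNormedModule)), inth; assumption.
  - now apply conth. }
assert (dPt : forall s t, I s -> J t ->
  is_derive (fun v => P s v) t (h s t - h s0 t)).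
{ intros s t Hs Ht.
  (* both sides are the integral of [ds h] in [s] *)
  replace (h s t - h s0 t) with (RInt (fun u => dt p u t) s0 s).
  - apply (is_derive_RInt_param (fun v u => p u v)).
    + apply filter_imp with (2 := open_interval_locally J t hJ Ht); intros v Hv u Hu.
      exists (dt p u v); apply smooth_on_is_derive_t; auto.
      exact (open_interval_convex I s0 s u hI Is0 Hs Hu).
    + intros u Hu; apply (continuity_2d_pt_swap (dt p)).
      apply smooth_on_continuity; auto using smooth_on_dt.
      exact (open_interval_convex I s0 s u hI Is0 Hs Hu).
    + apply filter_imp with (2 := open_interval_locally J t hJ Ht); intros v Hv.
      now apply intp.
  - apply is_RInt_unique.
    apply (is_RInt_ext (V := R_NormedModule) (fun u => ds h u t)).
    { intros u Hu; symmetry; apply Hclosed; [|assumption].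
      apply (open_interval_convex I s0 s u hI Is0 Hs); lra. }
    apply (is_RInt_derive (V := R_CompleteNormedModule) (fun u => h u t)).
    + intros u Hu; apply smooth_on_is_derive_s; auto.
      exact (open_interval_convex I s0 s u hI Is0 Hs Hu).
    + intros u Hu; apply (ex_derive_continuous (fun z => ds h z t)).
      exists (ds (ds h) u t); apply smooth_on_is_derive_s; auto using smooth_on_ds.
      exact (open_interval_convex I s0 s u hI Is0 Hs Hu). }
assert (dts : forall s t, I s -> J t -> is_derive (fun u => P u t + H t) s (p s t)).
{ intros s t Hs Ht; rewrite <- (Rplus_0_r (p s t)).
  apply @is_derive_plus; [now apply dPs | apply (is_derive_const (H t))]. }
assert (dtt : forall s t, I s -> J t -> is_derive (fun v => P s v + H v) t (h s t)).
{ intros s t Hs Ht; replace (h s t) with ((h s t - h s0 t) + h s0 t) by ring.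
  apply @is_derive_plus; [now apply dPt | now apply dH]. }
exists (fun s t => P s t + H t); intros s t Hs Ht; split; [|split]; auto.
apply continuity_2d_pt_of_partials with p.
- destruct (locally_2d_rectangle s t Hs Ht) as [d Hd].
  exists d; intros u v Hu Hv; destruct (Hd u v Hu Hv); auto.
- now apply smooth_on_continuity.
- apply continuity_pt_filterlim, (ex_derive_continuous (fun v => P s v + H v)).
  exists (h s t); auto.
Qed.

End Smooth.

(** * Lorentzian algebra of moving frames *)

Lemma E13_ext (u v : E13) : x1 u = x1 v -> x2 u = x2 v -> x3 u = x3 v -> u = v.
Proof.
destruct u as [[u1 u2] u3], v as [[v1 v2] v3]; unfold x1, x2, x3; simpl.
now intros -> -> ->.
Qed.

Ltac vector_ring :=
  repeat match goal with v : E13 |- _ => destruct v as [[? ?] ?] end;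
  try apply E13_ext;
  unfold lincomb, lprod, lcross, plus, scal, x1, x2, x3; simpl;
  unfold plus, scal, mult; simpl; unfold mult; simpl; ring.

Lemma lprod_sym (u v : E13) : lprod u v = lprod v u.
Proof. vector_ring. Qed.

Lemma lprod_lincomb_l (a b c : R) (u v w z : E13) :
  lprod (lincomb a b c u v w) z = a * lprod u z + b * lprod v z + c * lprod w z.
Proof. vector_ring. Qed.

Lemma lprod_lincomb_r (a b c : R) (u v w z : E13) :
  lprod z (lincomb a b c u v w) = a * lprod z u + b * lprod z v + c * lprod z w.
Proof. vector_ring. Qed.

Lemma lprod_plus_l (u v w : E13) : lprod (plus u v) w = lprod u w + lprod v w.
Proof. vector_ring. Qed.

Lemma lprod_scal_l (a : R) (u v : E13) : lprod (scal a u) v = a * lprod u v.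
Proof. vector_ring. Qed.

Lemma lprod_scal_r (a : R) (u v : E13) : lprod u (scal a v) = a * lprod u v.
Proof. vector_ring. Qed.

Lemma lprod_lcross_l (u v : E13) : lprod u (lcross u v) = 0.
Proof. vector_ring. Qed.

Lemma lprod_lcross_r (u v : E13) : lprod v (lcross u v) = 0.
Proof. vector_ring. Qed.

Lemma lprod_lcross_lcross (u v : E13) :
  lprod (lcross u v) (lcross u v) = lprod u v ^ 2 - lprod u u * lprod v v.
Proof. vector_ring. Qed.

Lemma lcross_lcross_l (u v : E13) :
  lcross u (lcross u v) = plus (scal (lprod u u) v) (scal (- lprod u v) u).
Proof. vector_ring. Qed.

Definition orthonormal (T N B : E13) : Prop :=
  lprod T T = 1 /\ lprod N N = -1 /\ lprod B B = 1 /\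
  lprod T N = 0 /\ lprod T B = 0 /\ lprod N B = 0.

Lemma orthonormal_lcross (T N : E13) :
  lprod T T = 1 -> lprod N N = -1 -> lprod T N = 0 -> orthonormal T N (lcross T N).
Proof.
intros TT NN TN; repeat split; auto.
- rewrite lprod_lcross_lcross, TT, NN, TN; ring.
- apply lprod_lcross_l.
- apply lprod_lcross_r.
Qed.

(** Cramer's rule for the triple [T], [N], [lcross T N], whose determinant is
    the square of [lcross T N]. *)
Lemma lcross_cramer (T N v : E13) :
  scal (lprod (lcross T N) (lcross T N)) v =
  plus (plus (scal (lprod v N * lprod T N - lprod v T * lprod N N) T)
             (scal (lprod v T * lprod T N - lprod v N * lprod T T) N))
       (scal (lprod v (lcross T N)) (lcross T N)).
Proof. vector_ring. Qed.

Lemma orthonormal_expansion (T N v : E13) :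
  lprod T T = 1 -> lprod N N = -1 -> lprod T N = 0 ->
  v = lincomb (lprod v T) (- lprod v N) (lprod v (lcross T N)) T N (lcross T N).
Proof.
intros TT NN TN.
assert (H := lcross_cramer T N v).
rewrite lprod_lcross_lcross, TT, NN, TN in H.
replace (0 ^ 2 - 1 * -1) with (one (K := R_AbsRing)) in H by (simpl; unfold one; simpl; ring).
rewrite scal_one in H; rewrite H at 1; unfold lincomb.
do 3 f_equal; ring.
Qed.

(** The general derivative of a frame of signature (+,-,+): preservation of the
    products leaves a matrix in the Lie algebra so(1,2), with three free
    entries. *)
Definition frame_matrix (a b w : R) (T N B dT dN dB : E13) : Prop :=
  dT = lincomb 0 a b T N B /\
  dN = lincomb a 0 w T N B /\
  dB = lincomb (- b) w 0 T N B.

(** The last three hypotheses are the derivatives of the three relations above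
    them, and the derivative of [lcross T N] is the one given by the product
    rule. *)
Lemma frame_matrix_lcross (T N dT dN : E13) :
  lprod T T = 1 -> lprod N N = -1 -> lprod T N = 0 ->
  lprod dT T = 0 -> lprod dN N = 0 -> lprod dT N + lprod T dN = 0 ->
  frame_matrix (- lprod dT N) (lprod dT (lcross T N)) (lprod dN (lcross T N))
    T N (lcross T N) dT dN (plus (lcross dT N) (lcross T dN)).
Proof.
intros TT NN TN dTT dNN dTN.
set (a := - lprod dT N); set (b := lprod dT (lcross T N)); set (w := lprod dN (lcross T N)).
assert (HT : dT = lincomb 0 a b T N (lcross T N)).
{ unfold a, b; rewrite <- dTT; apply orthonormal_expansion; assumption. }
assert (HN : dN = lincomb a 0 w T N (lcross T N)).
{ replace a with (lprod dN T) by (rewrite (lprod_sym dN T); unfold a; lra).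
  replace 0 with (- lprod dN N) by lra.
  unfold w; apply orthonormal_expansion; assumption. }
repeat split; auto.
rewrite HT, HN.
(* factors equal to 1, -1 or 0 are inserted to make the claim a polynomial identity *)
replace (lincomb (- b) w 0 T N (lcross T N)) with
  (lincomb (b * lprod N N) (w * lprod T T) 0 T N (lcross T N))
  by (rewrite TT, NN; f_equal; ring).
replace (lincomb (b * lprod N N) (w * lprod T T) 0 T N (lcross T N)) with
  (lincomb (b * lprod N N - w * lprod T N) (w * lprod T T - b * lprod T N) 0 T N (lcross T N))
  by (rewrite TN; f_equal; ring).
clearbody a b w; clear; vector_ring.
Qed.

Lemma frame_matrix_coefficients (a b w : R) (T N B dT dN dB : E13) :
  orthonormal T N B -> frame_matrix a b w T N B dT dN dB ->
  a = lprod dN T /\ b = lprod dT B /\ w = lprod dN B.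
Proof.
intros [TT [NN [BB [TN [TB NB]]]]] [-> [-> ->]]; rewrite !lprod_lincomb_l.
rewrite (lprod_sym B T), (lprod_sym N T), TT, NB, BB, TN, TB; repeat split; ring.
Qed.

(** The products of first derivatives that occur when the coefficients of one
    frame matrix are differentiated in the direction of the other. *)
Lemma frame_matrix_products (a b w a' b' w' : R) (T N B dT dN dB dT' dN' dB' : E13) :
  orthonormal T N B ->
  frame_matrix a b w T N B dT dN dB -> frame_matrix a' b' w' T N B dT' dN' dB' ->
  lprod dT dN' = b * w' /\ lprod dT dB' = - (a * w') /\ lprod dN dB' = - (a * b').
Proof.
intros [TT [NN [BB [TN [TB NB]]]]] [-> [-> ->]] [-> [-> ->]].
rewrite !lprod_lincomb_l, !lprod_lincomb_r.
rewrite (lprod_sym B T), (lprod_sym N T), (lprod_sym B N), TT, NN, NB, BB, TN, TB.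
repeat split; ring.
Qed.

(** * Derivatives of curves *)

Definition is_vderive (g : R -> E13) (s : R) (v : E13) : Prop :=
  is_derive (fun u => x1 (g u)) s (x1 v) /\
  is_derive (fun u => x2 (g u)) s (x2 v) /\
  is_derive (fun u => x3 (g u)) s (x3 v).

Lemma is_vderive_unique (g : R -> E13) (s : R) (v : E13) :
  is_vderive g s v -> vderive g s = v.
Proof.
intros [H1 [H2 H3]]; apply E13_ext; simpl; now apply is_derive_unique.
Qed.

Lemma vderive_ext_loc (f g : R -> E13) (s : R) :
  locally s (fun u => f u = g u) -> vderive f s = vderive g s.
Proof.
intros H; apply E13_ext; unfold vderive, x1, x2, x3; simpl; apply Derive_ext_loc;
  apply filter_imp with (2 := H); intros u Hu; now rewrite Hu.
Qed.

Lemma is_vderive_plus (f g : R -> E13) (s : R) (df dg : E13) :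
  is_vderive f s df -> is_vderive g s dg ->
  is_vderive (fun u => plus (f u) (g u)) s (plus df dg).
Proof.
intros [F1 [F2 F3]] [G1 [G2 G3]]; split; [|split].
- exact (is_derive_plus _ _ _ _ _ F1 G1).
- exact (is_derive_plus _ _ _ _ _ F2 G2).
- exact (is_derive_plus _ _ _ _ _ F3 G3).
Qed.

Lemma is_vderive_scal (a : R -> R) (g : R -> E13) (s da : R) (dg : E13) :
  is_derive a s da -> is_vderive g s dg ->
  is_vderive (fun u => scal (a u) (g u)) s (plus (scal da (g s)) (scal (a s) dg)).
Proof.
intros A [G1 [G2 G3]]; split; [|split].
- exact (Derive.is_derive_mult _ _ _ _ _ A G1).
- exact (Derive.is_derive_mult _ _ _ _ _ A G2).
- exact (Derive.is_derive_mult _ _ _ _ _ A G3).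
Qed.

Lemma is_derive_lprod (f g : R -> E13) (s : R) (df dg : E13) :
  is_vderive f s df -> is_vderive g s dg ->
  is_derive (fun u => lprod (f u) (g u)) s (lprod df (g s) + lprod (f s) dg).
Proof.
intros [F1 [F2 F3]] [G1 [G2 G3]].
replace (lprod df (g s) + lprod (f s) dg) with
  (- (x1 df * x1 (g s) + x1 (f s) * x1 dg) + (x2 df * x2 (g s) + x2 (f s) * x2 dg)
   + (x3 df * x3 (g s) + x3 (f s) * x3 dg)) by (unfold lprod; ring).
apply @is_derive_plus; [apply @is_derive_plus; [apply @is_derive_opp|]|];
  now apply Derive.is_derive_mult.
Qed.

Lemma is_derive_det2 (a b c d : R -> R) (s da db dc dd : R) :
  is_derive a s da -> is_derive b s db -> is_derive c s dc -> is_derive d s dd ->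
  is_derive (fun u => a u * b u - c u * d u) s
    ((da * b s - dc * d s) + (a s * db - c s * dd)).
Proof.
intros A B C D.
replace ((da * b s - dc * d s) + (a s * db - c s * dd)) with
  ((da * b s + a s * db) - (dc * d s + c s * dd)) by ring.
apply @is_derive_minus; now apply Derive.is_derive_mult.
Qed.

Lemma is_vderive_lcross (f g : R -> E13) (s : R) (df dg : E13) :
  is_vderive f s df -> is_vderive g s dg ->
  is_vderive (fun u => lcross (f u) (g u)) s (plus (lcross df (g s)) (lcross (f s) dg)).
Proof.
intros [F1 [F2 F3]] [G1 [G2 G3]]; split; [|split].
- apply (is_derive_ext (fun u => x3 (f u) * x2 (g u) - x2 (f u) * x3 (g u))).
  { intros u; unfold lcross, x1, x2, x3; simpl; ring. }
  replace (x1 (plus (lcross df (g s)) (lcross (f s) dg))) with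
    ((x3 df * x2 (g s) - x2 df * x3 (g s)) + (x3 (f s) * x2 dg - x2 (f s) * x3 dg))
    by (unfold lcross, x1, x2, x3; simpl; unfold plus; simpl; ring).
  apply (is_derive_det2 (fun u => x3 (f u)) (fun u => x2 (g u))
    (fun u => x2 (f u)) (fun u => x3 (g u))); assumption.
- exact (is_derive_det2 _ _ _ _ _ _ _ _ _ F3 G1 F1 G3).
- exact (is_derive_det2 _ _ _ _ _ _ _ _ _ F1 G2 F2 G1).
Qed.

Lemma is_derive_cosh (x : R) : is_derive cosh x (sinh x).
Proof. apply is_derive_Reals, derivable_pt_lim_cosh. Qed.

Lemma is_derive_sinh (x : R) : is_derive sinh x (cosh x).
Proof. apply is_derive_Reals, derivable_pt_lim_sinh. Qed.

Lemma cosh2_sinh2 (x : R) : cosh x ^ 2 - sinh x ^ 2 = 1.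
Proof.
unfold cosh, sinh.
replace 1 with (exp x * exp (- x)) by (rewrite <- exp_plus, Rplus_opp_r; apply exp_0).
field.
Qed.

(** * Lorentz boosts of the normal plane *)

Definition boost1 (th : R) (N B : E13) : E13 := plus (scal (cosh th) N) (scal (sinh th) B).
Definition boost2 (th : R) (N B : E13) : E13 := plus (scal (sinh th) N) (scal (cosh th) B).

Lemma orthonormal_boost (th : R) (T N B : E13) :
  orthonormal T N B -> orthonormal T (boost1 th N B) (boost2 th N B).
Proof.
intros [TT [NN [BB [TN [TB NB]]]]].
assert (Hb : forall a b u v, lprod u (plus (scal a N) (scal b v)) = a * lprod u N + b * lprod u v)
  by (intros; vector_ring).
assert (Hb' : forall a b u v, lprod (plus (scal a N) (scal b v)) u = a * lprod N u + b * lprod v u)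
  by (intros; vector_ring).
assert (BN : lprod B N = 0) by (rewrite lprod_sym; exact NB).
assert (C := cosh2_sinh2 th).
unfold boost1, boost2; repeat split; rewrite ?Hb, ?Hb', ?TT, ?NN, ?BB, ?TN, ?TB, ?NB, ?BN; nra.
Qed.

(** A gauge transformation: boosting the normal plane by the angle [th] boosts
    the curvatures and adds the derivative of [th] to the rotation rate [w] of
    the normal plane.  A suitable [th] therefore cancels [w]. *)
Lemma frame_matrix_boost (a b w : R) (dth : R) (th : R -> R) (T N B : R -> E13) (x : R)
    (dT dN dB : E13) :
  is_vderive N x dN -> is_vderive B x dB ->
  frame_matrix a b w (T x) (N x) (B x) dT dN dB ->
  is_derive th x dth ->
  frame_matrix (a * cosh (th x) - b * sinh (th x)) (b * cosh (th x) - a * sinh (th x)) (w + dth)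
    (T x) (boost1 (th x) (N x) (B x)) (boost2 (th x) (N x) (B x))
    dT (vderive (fun u => boost1 (th u) (N u) (B u)) x)
       (vderive (fun u => boost2 (th u) (N u) (B u)) x).
Proof.
intros DN DB [HT [HN HB]] Dth.
assert (DC := is_derive_comp cosh th x _ _ (is_derive_cosh (th x)) Dth).
assert (DS := is_derive_comp sinh th x _ _ (is_derive_sinh (th x)) Dth).
assert (D1 : vderive (fun u => boost1 (th u) (N u) (B u)) x = _)
  by exact (is_vderive_unique _ _ _ (is_vderive_plus _ _ _ _ _
      (is_vderive_scal _ _ _ _ _ DC DN) (is_vderive_scal _ _ _ _ _ DS DB))).
assert (D2 : vderive (fun u => boost2 (th u) (N u) (B u)) x = _)
  by exact (is_vderive_unique _ _ _ (is_vderive_plus _ _ _ _ _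
      (is_vderive_scal _ _ _ _ _ DS DN) (is_vderive_scal _ _ _ _ _ DC DB))).
assert (C := cosh2_sinh2 (th x)).
rewrite D1, D2; clear D1 D2 DC DS; subst dN dB; unfold boost1, boost2.
split; [|split].
(* as above, [cosh ^ 2 - sinh ^ 2] is inserted to obtain a polynomial identity *)
- rewrite HT; replace (lincomb 0 a b (T x) (N x) (B x)) with
    (lincomb 0 (a * (cosh (th x) ^ 2 - sinh (th x) ^ 2)) (b * (cosh (th x) ^ 2 - sinh (th x) ^ 2))
       (T x) (N x) (B x)) by (rewrite C; f_equal; ring).
  generalize (T x) (N x) (B x) (cosh (th x)) (sinh (th x)); clear; intros; vector_ring.
- generalize (T x) (N x) (B x) (cosh (th x)) (sinh (th x)); clear; intros; vector_ring.
- generalize (T x) (N x) (B x) (cosh (th x)) (sinh (th x)); clear; intros; vector_ring.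
Qed.

(** * Smooth fields and moving frames *)

Section Fields.

Variables I J : R -> Prop.
Hypotheses (hI : is_open_interval I) (hJ : is_open_interval J).

Let smooth_of_expr := smooth_expr_smooth I J hI hJ.

Lemma smooth_on_const (c : R) : smooth_on I J (fun _ _ => c).
Proof. apply smooth_of_expr, sx_const. Qed.

Lemma smooth_on_plus (f g : R -> R -> R) :
  smooth_on I J f -> smooth_on I J g -> smooth_on I J (fun s t => f s t + g s t).
Proof. intros; apply smooth_of_expr, sx_plus; now apply sx_atom. Qed.

Lemma smooth_on_mult (f g : R -> R -> R) :
  smooth_on I J f -> smooth_on I J g -> smooth_on I J (fun s t => f s t * g s t).
Proof. intros; apply smooth_of_expr, sx_mult; now apply sx_atom. Qed.

Lemma smooth_on_opp (f : R -> R -> R) :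
  smooth_on I J f -> smooth_on I J (fun s t => - f s t).
Proof.
intros Hf; apply (smooth_on_ext I J hI hJ (fun s t => -1 * f s t)).
- intros s t _ _; ring.
- apply smooth_on_mult; auto using smooth_on_const.
Qed.

Lemma smooth_on_exp (f : R -> R -> R) :
  smooth_on I J f -> smooth_on I J (fun s t => exp (f s t)).
Proof. intros; apply smooth_of_expr, sx_exp; now apply sx_atom. Qed.

Lemma smooth_on_cosh (f : R -> R -> R) :
  smooth_on I J f -> smooth_on I J (fun s t => cosh (f s t)).
Proof.
intros Hf; apply (smooth_on_mult (fun s t => exp (f s t) + exp (- f s t)) (fun _ _ => / 2)).
- apply smooth_on_plus; apply smooth_on_exp; auto using smooth_on_opp.
- apply smooth_on_const.
Qed.

Lemma smooth_on_sinh (f : R -> R -> R) :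
  smooth_on I J f -> smooth_on I J (fun s t => sinh (f s t)).
Proof.
intros Hf; apply (smooth_on_mult (fun s t => exp (f s t) + - exp (- f s t)) (fun _ _ => / 2)).
- apply smooth_on_plus; [|apply smooth_on_opp]; apply smooth_on_exp; auto using smooth_on_opp.
- apply smooth_on_const.
Qed.

Lemma vsmooth_on_Ds (F : R -> R -> E13) : vsmooth_on I J F -> vsmooth_on I J (Ds F).
Proof.
intros [F1 [F2 F3]]; split; [|split]; [exact (smooth_on_ds _ _ _ F1)
  | exact (smooth_on_ds _ _ _ F2) | exact (smooth_on_ds _ _ _ F3)].
Qed.

Lemma vsmooth_on_Dt (F : R -> R -> E13) : vsmooth_on I J F -> vsmooth_on I J (Dt F).
Proof.
intros [F1 [F2 F3]]; split; [|split]; [exact (smooth_on_dt _ _ _ F1)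
  | exact (smooth_on_dt _ _ _ F2) | exact (smooth_on_dt _ _ _ F3)].
Qed.

Lemma vsmooth_on_plus (F G : R -> R -> E13) : vsmooth_on I J F -> vsmooth_on I J G ->
  vsmooth_on I J (fun s t => plus (F s t) (G s t)).
Proof.
intros [F1 [F2 F3]] [G1 [G2 G3]]; split; [|split]; [exact (smooth_on_plus _ _ F1 G1)
  | exact (smooth_on_plus _ _ F2 G2) | exact (smooth_on_plus _ _ F3 G3)].
Qed.

Lemma vsmooth_on_scal (a : R -> R -> R) (F : R -> R -> E13) :
  smooth_on I J a -> vsmooth_on I J F -> vsmooth_on I J (fun s t => scal (a s t) (F s t)).
Proof.
intros A [F1 [F2 F3]]; split; [|split]; [exact (smooth_on_mult _ _ A F1)
  | exact (smooth_on_mult _ _ A F2) | exact (smooth_on_mult _ _ A F3)].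
Qed.

Lemma smooth_on_lprod (F G : R -> R -> E13) : vsmooth_on I J F -> vsmooth_on I J G ->
  smooth_on I J (fun s t => lprod (F s t) (G s t)).
Proof.
intros [F1 [F2 F3]] [G1 [G2 G3]]; unfold lprod.
repeat apply smooth_on_plus; [apply smooth_on_opp|..]; now apply smooth_on_mult.
Qed.

Lemma vsmooth_on_lcross (F G : R -> R -> E13) : vsmooth_on I J F -> vsmooth_on I J G ->
  vsmooth_on I J (fun s t => lcross (F s t) (G s t)).
Proof.
intros [F1 [F2 F3]] [G1 [G2 G3]]; split; [|split].
- apply (smooth_on_plus (fun s t => - (x2 (F s t) * x3 (G s t)))
    (fun s t => x3 (F s t) * x2 (G s t))); [apply smooth_on_opp|]; now apply smooth_on_mult.
- apply (smooth_on_plus (fun s t => x3 (F s t) * x1 (G s t))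
    (fun s t => - (x1 (F s t) * x3 (G s t)))); [|apply smooth_on_opp]; now apply smooth_on_mult.
- apply (smooth_on_plus (fun s t => x1 (F s t) * x2 (G s t))
    (fun s t => - (x2 (F s t) * x1 (G s t)))); [|apply smooth_on_opp]; now apply smooth_on_mult.
Qed.

Lemma vsmooth_on_is_vderive_s (F : R -> R -> E13) (s t : R) :
  vsmooth_on I J F -> I s -> J t -> is_vderive (fun u => F u t) s (Ds F s t).
Proof.
intros [F1 [F2 F3]] Hs Ht; split; [|split];
  [exact (smooth_on_is_derive_s _ _ _ s t F1 Hs Ht) | exact (smooth_on_is_derive_s _ _ _ s t F2 Hs Ht)
  | exact (smooth_on_is_derive_s _ _ _ s t F3 Hs Ht)].
Qed.

Lemma vsmooth_on_is_vderive_t (F : R -> R -> E13) (s t : R) :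
  vsmooth_on I J F -> I s -> J t -> is_vderive (fun u => F s u) t (Dt F s t).
Proof.
intros [F1 [F2 F3]] Hs Ht; split; [|split];
  [exact (smooth_on_is_derive_t _ _ _ s t F1 Hs Ht) | exact (smooth_on_is_derive_t _ _ _ s t F2 Hs Ht)
  | exact (smooth_on_is_derive_t _ _ _ s t F3 Hs Ht)].
Qed.

Lemma vsmooth_on_schwarz (F : R -> R -> E13) (s t : R) :
  vsmooth_on I J F -> I s -> J t -> Ds (Dt F) s t = Dt (Ds F) s t.
Proof.
intros [F1 [F2 F3]] Hs Ht; apply E13_ext; [exact (smooth_on_schwarz I J hI hJ _ s t F1 Hs Ht)
  | exact (smooth_on_schwarz I J hI hJ _ s t F2 Hs Ht)
  | exact (smooth_on_schwarz I J hI hJ _ s t F3 Hs Ht)].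
Qed.

Lemma Ds_ext (F G : R -> R -> E13) (s t : R) :
  (forall u v, I u -> J v -> F u v = G u v) -> I s -> J t -> Ds F s t = Ds G s t.
Proof.
intros E Hs Ht; apply vderive_ext_loc.
apply filter_imp with (2 := open_interval_locally I s hI Hs); intros u Hu; auto.
Qed.

Lemma ds_lprod (F G : R -> R -> E13) (f : R -> R -> R) (s t : R) :
  vsmooth_on I J F -> vsmooth_on I J G ->
  eq_on I J f (fun u v => lprod (F u v) (G u v)) -> I s -> J t ->
  ds f s t = lprod (Ds F s t) (G s t) + lprod (F s t) (Ds G s t).
Proof.
intros HF HG E Hs Ht; apply is_derive_unique.
apply (is_derive_ext_s I J hI (fun u v => lprod (F u v) (G u v)) f s t); auto.
{ intros u v Hu Hv; symmetry; auto. }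
apply (is_derive_lprod (fun u => F u t) (fun u => G u t)); now apply vsmooth_on_is_vderive_s.
Qed.

Lemma dt_lprod (F G : R -> R -> E13) (f : R -> R -> R) (s t : R) :
  vsmooth_on I J F -> vsmooth_on I J G ->
  eq_on I J f (fun u v => lprod (F u v) (G u v)) -> I s -> J t ->
  dt f s t = lprod (Dt F s t) (G s t) + lprod (F s t) (Dt G s t).
Proof.
intros HF HG E Hs Ht; apply is_derive_unique.
apply (is_derive_ext_t I J hJ (fun u v => lprod (F u v) (G u v)) f s t); auto.
{ intros u v Hu Hv; symmetry; auto. }
apply (is_derive_lprod (fun u => F s u) (fun u => G s u)); now apply vsmooth_on_is_vderive_t.
Qed.

(** Unprimed coefficients describe the motion of the frame in [s], primed ones
    its motion in [t]. *)
Definition moving_frame (T N B : R -> R -> E13) (a b w a' b' w' : R -> R -> R) : Prop :=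
  (vsmooth_on I J T /\ vsmooth_on I J N /\ vsmooth_on I J B) /\
  forall s t, I s -> J t ->
    orthonormal (T s t) (N s t) (B s t) /\
    frame_matrix (a s t) (b s t) (w s t) (T s t) (N s t) (B s t)
      (Ds T s t) (Ds N s t) (Ds B s t) /\
    frame_matrix (a' s t) (b' s t) (w' s t) (T s t) (N s t) (B s t)
      (Dt T s t) (Dt N s t) (Dt B s t).

(** The zero curvature equations.  Each coefficient is the product of a first
    derivative of one frame vector with another frame vector; in the difference
    of the cross derivatives the second derivatives cancel by Schwarz's
    theorem, and only products of first derivatives remain. *)
Lemma moving_frame_compatibility (T N B : R -> R -> E13) (a b w a' b' w' : R -> R -> R)
    (s t : R) :
  moving_frame T N B a b w a' b' w' -> I s -> J t ->
  ds a' s t - dt a s t = b s t * w' s t - b' s t * w s t /\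
  ds b' s t - dt b s t = a s t * w' s t - a' s t * w s t /\
  ds w' s t - dt w s t = a s t * b' s t - a' s t * b s t.
Proof.
intros [[ST [SN SB]] H] Hs Ht.
assert (Hc : forall u v, I u -> J v ->
  (a u v = lprod (Ds N u v) (T u v) /\ b u v = lprod (Ds T u v) (B u v) /\
   w u v = lprod (Ds N u v) (B u v)) /\
  (a' u v = lprod (Dt N u v) (T u v) /\ b' u v = lprod (Dt T u v) (B u v) /\
   w' u v = lprod (Dt N u v) (B u v))).
{ intros u v Hu Hv; destruct (H u v Hu Hv) as [O [Ms Mt]].
  split; [exact (frame_matrix_coefficients _ _ _ _ _ _ _ _ _ O Ms)
         | exact (frame_matrix_coefficients _ _ _ _ _ _ _ _ _ O Mt)]. }
destruct (H s t Hs Ht) as [O [Ms Mt]].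
destruct (frame_matrix_products _ _ _ _ _ _ _ _ _ _ _ _ _ _ _ O Ms Mt) as [P1 [P2 P3]].
destruct (frame_matrix_products _ _ _ _ _ _ _ _ _ _ _ _ _ _ _ O Mt Ms) as [Q1 [Q2 Q3]].
rewrite (ds_lprod (Dt N) T a'), (dt_lprod (Ds N) T a), (ds_lprod (Dt T) B b'),
  (dt_lprod (Ds T) B b), (ds_lprod (Dt N) B w'), (dt_lprod (Ds N) B w);
  auto using vsmooth_on_Ds, vsmooth_on_Dt; try (intros u v Hu Hv; now apply Hc).
rewrite !vsmooth_on_schwarz, (lprod_sym (Dt N s t) (Ds T s t)), (lprod_sym (Ds N s t) (Dt T s t));
  auto; lra.
Qed.

Lemma moving_frame_boost (T N B : R -> R -> E13) (a b w a' b' w' th ths tht : R -> R -> R) :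
  moving_frame T N B a b w a' b' w' ->
  c1_with I J th ths tht -> smooth_on I J th ->
  moving_frame T (fun s t => boost1 (th s t) (N s t) (B s t))
    (fun s t => boost2 (th s t) (N s t) (B s t))
    (fun s t => a s t * cosh (th s t) - b s t * sinh (th s t))
    (fun s t => b s t * cosh (th s t) - a s t * sinh (th s t))
    (fun s t => w s t + ths s t)
    (fun s t => a' s t * cosh (th s t) - b' s t * sinh (th s t))
    (fun s t => b' s t * cosh (th s t) - a' s t * sinh (th s t))
    (fun s t => w' s t + tht s t).
Proof.
intros [[ST [SN SB]] H] Dth Sth; split.
- split; [assumption|]; split; apply vsmooth_on_plus; apply vsmooth_on_scal;
    auto using smooth_on_cosh, smooth_on_sinh.
- intros s t Is Jt; destruct (H s t Is Jt) as [O [Ms Mt]], (Dth s t Is Jt) as [_ [Ds_th Dt_th]].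
  split; [now apply orthonormal_boost|]; split.
  + apply (frame_matrix_boost _ _ _ _ (fun u => th u t) (fun u => T u t) (fun u => N u t)
      (fun u => B u t) s (Ds T s t) (Ds N s t) (Ds B s t)); auto using vsmooth_on_is_vderive_s.
  + apply (frame_matrix_boost _ _ _ _ (fun u => th s u) (fun u => T s u) (fun u => N s u)
      (fun u => B s u) t (Dt T s t) (Dt N s t) (Dt B s t)); auto using vsmooth_on_is_vderive_t.
Qed.

(** The last hypotheses of [frame_matrix_lcross] are the derivatives of the three
    constant products. *)
Lemma moving_frame_lcross (T N : R -> R -> E13) :
  vsmooth_on I J T -> vsmooth_on I J N ->
  (forall s t, I s -> J t ->
     lprod (T s t) (T s t) = 1 /\ lprod (N s t) (N s t) = -1 /\ lprod (T s t) (N s t) = 0) ->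
  let B := fun s t => lcross (T s t) (N s t) in
  moving_frame T N B
    (fun s t => - lprod (Ds T s t) (N s t)) (fun s t => lprod (Ds T s t) (B s t))
    (fun s t => lprod (Ds N s t) (B s t))
    (fun s t => - lprod (Dt T s t) (N s t)) (fun s t => lprod (Dt T s t) (B s t))
    (fun s t => lprod (Dt N s t) (B s t)).
Proof.
intros ST SN H B.
assert (SB : vsmooth_on I J B) by now apply vsmooth_on_lcross.
split; [auto|]; intros s t Is Jt.
destruct (H s t Is Jt) as [TT [NN TN]].
assert (Zs : forall c : R, ds (fun _ _ => c) s t = 0) by (intros c; exact (Derive_const c s)).
assert (Zt : forall c : R, dt (fun _ _ => c) s t = 0) by (intros c; exact (Derive_const c t)).
split; [now apply orthonormal_lcross|]; split.
- replace (Ds B s t) with (plus (lcross (Ds T s t) (N s t)) (lcross (T s t) (Ds N s t))).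
  2:{ symmetry; apply is_vderive_unique, (is_vderive_lcross (fun u => T u t) (fun u => N u t));
      now apply vsmooth_on_is_vderive_s. }
  apply frame_matrix_lcross; auto.
  + assert (E := Zs 1); rewrite (ds_lprod T T) in E; auto; [|intros u v Iu Jv; symmetry; now apply H].
    rewrite (lprod_sym (T s t)) in E; lra.
  + assert (E := Zs (-1)); rewrite (ds_lprod N N) in E; auto; [|intros u v Iu Jv; symmetry; now apply H].
    rewrite (lprod_sym (N s t)) in E; lra.
  + rewrite <- (Zs 0); symmetry; apply (ds_lprod T N); auto; intros u v Iu Jv; symmetry; now apply H.
- replace (Dt B s t) with (plus (lcross (Dt T s t) (N s t)) (lcross (T s t) (Dt N s t))).
  2:{ symmetry; apply is_vderive_unique, (is_vderive_lcross (fun u => T s u) (fun u => N s u));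
      now apply vsmooth_on_is_vderive_t. }
  apply frame_matrix_lcross; auto.
  + assert (E := Zt 1); rewrite (dt_lprod T T) in E; auto; [|intros u v Iu Jv; symmetry; now apply H].
    rewrite (lprod_sym (T s t)) in E; lra.
  + assert (E := Zt (-1)); rewrite (dt_lprod N N) in E; auto; [|intros u v Iu Jv; symmetry; now apply H].
    rewrite (lprod_sym (N s t)) in E; lra.
  + rewrite <- (Zt 0); symmetry; apply (dt_lprod T N); auto; intros u v Iu Jv; symmetry; now apply H.
Qed.

(** * The tangent along the vortex filament flow *)

(** Differentiate the flow in [s] and exchange the partial derivatives; the
    term [lcross T_s T_s] vanishes. *)
Lemma tangent_evolution (alpha : R -> R -> E13) (s t : R) :
  vsmooth_on I J alpha -> vortex_filament I J alpha -> I s -> J t ->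
  Dt (Ds alpha) s t = lcross (Ds alpha s t) (Ds (Ds (Ds alpha)) s t).
Proof.
intros Sa V Is Jt; rewrite <- vsmooth_on_schwarz by assumption.
rewrite (Ds_ext (Dt alpha) (fun s t => lcross (Ds alpha s t) (Ds (Ds alpha) s t))) by auto.
assert (D : Ds (fun s t => lcross (Ds alpha s t) (Ds (Ds alpha) s t)) s t = _)
  by exact (is_vderive_unique _ _ _ (is_vderive_lcross _ _ _ _ _
      (vsmooth_on_is_vderive_s _ s t (vsmooth_on_Ds _ Sa) Is Jt)
      (vsmooth_on_is_vderive_s _ s t (vsmooth_on_Ds _ (vsmooth_on_Ds _ Sa)) Is Jt))).
rewrite D; generalize (Ds alpha s t) (Ds (Ds alpha) s t) (Ds (Ds (Ds alpha)) s t).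
intros u v w; vector_ring.
Qed.

(** The flow preserves arclength because [T_t] is a Lorentzian product with [T],
    hence orthogonal to [T]. *)
Lemma unit_tangent (alpha : R -> R -> E13) (s t : R) :
  J 0 -> vsmooth_on I J alpha -> vortex_filament I J alpha ->
  lprod (Ds alpha s 0) (Ds alpha s 0) = 1 -> I s -> J t ->
  lprod (Ds alpha s t) (Ds alpha s t) = 1.
Proof.
intros J0 Sa V H Is Jt; rewrite <- H.
set (f := fun v => lprod (Ds alpha s v) (Ds alpha s v)).
assert (Df : forall v, J v -> is_derive f v 0).
{ intros v Jv; assert (D := vsmooth_on_is_vderive_t _ s v (vsmooth_on_Ds _ Sa) Is Jv).
  replace 0 with (lprod (Dt (Ds alpha) s v) (Ds alpha s v) + lprod (Ds alpha s v) (Dt (Ds alpha) s v)).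
  - now apply (is_derive_lprod (Ds alpha s) (Ds alpha s)).
  - rewrite (lprod_sym (Dt _ _ _)), tangent_evolution, lprod_lcross_l by assumption; ring. }
change (f t = f 0).
destruct (MVT_gen f 0 t (fun _ => 0)) as [c [_ Hc]]; [| |lra].
- intros x Hx; apply Df, (open_interval_convex J 0 t x hJ J0 Jt); lra.
- intros x Hx; apply continuity_pt_filterlim, (ex_derive_continuous f).
  exists 0; apply Df, (open_interval_convex J 0 t x hJ J0 Jt); lra.
Qed.

(** * The heat system *)

Lemma ds_linear_combination (a b : R) (f g h : R -> R -> R) :
  smooth_on I J g -> smooth_on I J h ->
  eq_on I J f (fun s t => a * g s t + b * h s t) ->
  eq_on I J (ds f) (fun s t => a * ds g s t + b * ds h s t).
Proof.
intros Sg Sh E s t Is Jt; apply is_derive_unique.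
apply (is_derive_ext_s I J hI (fun s t => a * g s t + b * h s t) f s t); auto.
{ intros u v Iu Jv; symmetry; auto. }
apply @is_derive_plus; apply is_derive_scal; now apply (smooth_on_is_derive_s I J).
Qed.

Lemma dt_linear_combination (a b : R) (f g h : R -> R -> R) :
  smooth_on I J g -> smooth_on I J h ->
  eq_on I J f (fun s t => a * g s t + b * h s t) ->
  eq_on I J (dt f) (fun s t => a * dt g s t + b * dt h s t).
Proof.
intros Sg Sh E s t Is Jt; apply is_derive_unique.
apply (is_derive_ext_t I J hJ (fun s t => a * g s t + b * h s t) f s t); auto.
{ intros u v Iu Jv; symmetry; auto. }
apply @is_derive_plus; apply is_derive_scal; now apply (smooth_on_is_derive_t I J).
Qed.

Lemma smooth_on_linear_combination (a b : R) (f g h : R -> R -> R) :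
  smooth_on I J g -> smooth_on I J h ->
  eq_on I J f (fun s t => a * g s t + b * h s t) -> smooth_on I J f.
Proof.
intros Sg Sh E; apply (smooth_on_ext I J hI hJ (fun s t => a * g s t + b * h s t)).
- intros u v Iu Jv; symmetry; auto.
- apply smooth_on_plus; apply smooth_on_mult; auto using smooth_on_const.
Qed.

(** The zero curvature equations of a parallel frame, with
    [w' = (k1^2 - k2^2) / 2], give the evolution of [k1] and [k2]; in the null
    coordinates [q], [r] of the normal plane [w'] becomes [- q * r] and the
    second order parts decouple. *)
Lemma heat_system_of_parallel_frame (alpha E1 E2 : R -> R -> E13) (k1 k2 : R -> R -> R) :
  vsmooth_on I J alpha -> vortex_parallel_frame I J alpha E1 E2 k1 k2 ->
  nonlinear_heat_system I J
       (fun s t => 1 / sqrt 2 * (k1 s t + k2 s t))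
       (fun s t => - (1 / sqrt 2) * (k1 s t - k2 s t)).
Proof.
intros Sa [S1 [S2 [Sk1 [Sk2 [Hf [Hs Ht]]]]]].
assert (M : moving_frame (Ds alpha) E1 E2 k1 k2 (fun _ _ => 0) (ds k2) (ds k1)
  (fun s t => 1 / 2 * (k1 s t ^ 2 - k2 s t ^ 2))).
{ split; [auto using vsmooth_on_Ds|].
  intros s t Is Jt; split; [|split].
  - destruct (Hf t Jt) as [P _]; destruct (P s Is) as [TT [NN [BB [TN [TB [NB _]]]]]].
    repeat split; assumption.
  - exact (Hs s t Is Jt).
  - exact (Ht s t Is Jt). }
set (c := 1 / sqrt 2).
assert (Hc : c ^ 2 = / 2).
{ unfold c; replace 2 with (sqrt 2 * sqrt 2) at 2 by (apply sqrt_def; lra).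
  field; apply Rgt_not_eq, sqrt_lt_R0; lra. }
set (q := fun s t => c * (k1 s t + k2 s t)).
set (r := fun s t => - c * (k1 s t - k2 s t)).
assert (Eq : eq_on I J q (fun s t => c * k1 s t + c * k2 s t))
  by (intros s t _ _; unfold q; ring).
assert (Er : eq_on I J r (fun s t => (- c) * k1 s t + c * k2 s t))
  by (intros s t _ _; unfold r; ring).
split; [|split].
- exact (smooth_on_linear_combination _ _ _ _ _ Sk1 Sk2 Eq).
- exact (smooth_on_linear_combination _ _ _ _ _ Sk1 Sk2 Er).
- intros s t Is Jt.
  destruct (moving_frame_compatibility _ _ _ _ _ _ _ _ _ s t M Is Jt) as [C1 [C2 _]].
  rewrite (dt_linear_combination _ _ _ _ _ Sk1 Sk2 Eq), (dt_linear_combination _ _ _ _ _ Sk1 Sk2 Er)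
    by assumption.
  rewrite (ds_linear_combination c c (ds q) (ds k1) (ds k2)),
    (ds_linear_combination (- c) c (ds r) (ds k1) (ds k2));
    auto using smooth_on_ds, ds_linear_combination.
  replace (dt k1 s t) with (ds (ds k2) s t - 1 / 2 * (k1 s t ^ 2 - k2 s t ^ 2) * k2 s t) by lra.
  replace (dt k2 s t) with (ds (ds k1) s t - 1 / 2 * (k1 s t ^ 2 - k2 s t ^ 2) * k1 s t) by lra.
  unfold q, r; generalize (ds (ds k1) s t) (ds (ds k2) s t) (k1 s t) (k2 s t).
  intros d1 d2 a b; split; apply Rminus_diag_uniq.
  + transitivity (c * (c ^ 2 - / 2) * ((a + b) ^ 2 * (a - b))); [field | rewrite Hc; ring].
  + transitivity (c * (c ^ 2 - / 2) * ((a - b) ^ 2 * (a + b))); [field | rewrite Hc; ring].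
Qed.

End Fields.

(** * Existence of the parallel frame *)

Section Main.

Variables I J : R -> Prop.
Hypotheses (hI : is_open_interval I) (hJ : is_open_interval J).

Lemma moving_frame_ext (T N B : R -> R -> E13)
    (a b w a' b' w' k l m k' l' m' : R -> R -> R) :
  moving_frame I J T N B a b w a' b' w' ->
  eq_on I J a k -> eq_on I J b l -> eq_on I J w m ->
  eq_on I J a' k' -> eq_on I J b' l' -> eq_on I J w' m' ->
  moving_frame I J T N B k l m k' l' m'.
Proof.
intros [S H] Ea Eb Ew Ea' Eb' Ew'; split; [exact S|]; intros s t Is Jt.
rewrite <- Ea, <- Eb, <- Ew, <- Ea', <- Eb', <- Ew' by assumption; auto.
Qed.

(** The condition [lprod N N = -1] determines the sign of [lprod T_s T_s]. *)
Lemma curvature_timelike (alpha : R -> R -> E13) (s t : R) :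
  timelike_principal_normal I (fun u => alpha u t) -> I s ->
  let kap := curvature (fun u => alpha u t) s in
  0 < kap /\ lprod (Ds (Ds alpha) s t) (Ds (Ds alpha) s t) = - kap ^ 2.
Proof.
intros H Is kap; destruct (H s Is) as [Hne HN].
fold kap in Hne; unfold principal_normal in HN; fold kap in HN.
change (vderive (vderive (fun u => alpha u t)) s) with (Ds (Ds alpha) s t) in HN.
rewrite lprod_scal_l, lprod_scal_r in HN.
split.
- destruct (Rle_lt_or_eq_dec 0 kap) as [|E]; [apply sqrt_pos | assumption | now destruct Hne].
- replace (lprod (Ds (Ds alpha) s t) (Ds (Ds alpha) s t)) with
    (kap ^ 2 * (/ kap * (/ kap * lprod (Ds (Ds alpha) s t) (Ds (Ds alpha) s t))))
    by (field; assumption).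
  rewrite HN; ring.
Qed.

(** The Frenet frame of the filament.  Substituting the Frenet equations for
    [T_ss] into [T_t = lcross T T_ss] gives the [t]-coefficients of [T]; the
    normal rotation rate [nu] in [t] is left undetermined. *)
Lemma frenet_moving_frame (alpha : R -> R -> E13) :
  vsmooth_on I J alpha -> vortex_filament I J alpha ->
  (forall t, J t -> timelike_principal_normal I (fun s => alpha s t)) ->
  (forall s t, I s -> J t -> lprod (Ds alpha s t) (Ds alpha s t) = 1) ->
  exists (N B : R -> R -> E13) (kap tau nu : R -> R -> R),
    (smooth_on I J kap /\ smooth_on I J tau /\ smooth_on I J nu) /\
    moving_frame I J (Ds alpha) N B kap (fun _ _ => 0) tau
      (fun s t => kap s t * tau s t) (ds kap) nu.
Proof.
intros Sa V HN Hunit.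
set (T := Ds alpha).
assert (ST : vsmooth_on I J T) by now apply vsmooth_on_Ds.
assert (STs : vsmooth_on I J (Ds T)) by now apply vsmooth_on_Ds.
set (kap := fun s t => curvature (fun u => alpha u t) s).
assert (Hkap : forall s t, I s -> J t ->
  0 < kap s t /\ lprod (Ds T s t) (Ds T s t) = - kap s t ^ 2).
{ intros s t Is Jt; exact (curvature_timelike alpha s t (HN t Jt) Is). }
assert (Skap : smooth_on I J kap).
{ apply (smooth_on_ext I J hI hJ (fun s t => sqrt (- lprod (Ds T s t) (Ds T s t)))).
  - intros s t Is Jt; destruct (Hkap s t Is Jt) as [Hp ->].
    rewrite Ropp_involutive; apply sqrt_pow2; lra.
  - apply smooth_expr_smooth; auto; apply sx_sqrt.
    + intros s t Is Jt; destruct (Hkap s t Is Jt) as [Hp ->]; nra.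
    + apply sx_atom, smooth_on_opp; auto; now apply smooth_on_lprod. }
set (N := fun s t => scal (/ kap s t) (Ds T s t)).
assert (SN : vsmooth_on I J N).
{ apply vsmooth_on_scal; auto; apply smooth_expr_smooth; auto; apply sx_inv.
  - intros s t Is Jt; apply Rgt_not_eq, Hkap; assumption.
  - now apply sx_atom. }
set (B := fun s t => lcross (T s t) (N s t)).
assert (HTs : forall s t, I s -> J t -> Ds T s t = scal (kap s t) (N s t)).
{ intros s t Is Jt; unfold N; rewrite scal_assoc.
  change (mult (kap s t) (/ kap s t)) with (kap s t * / kap s t).
  rewrite Rinv_r by (apply Rgt_not_eq, Hkap; assumption).
  symmetry; exact (scal_one (Ds T s t)). }
assert (HT : forall s t, I s -> J t ->
  lprod (T s t) (T s t) = 1 /\ lprod (N s t) (N s t) = -1 /\ lprod (T s t) (N s t) = 0).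
{ intros s t Is Jt; destruct (Hkap s t Is Jt) as [Hp Hk]; repeat split.
  - now apply Hunit.
  - unfold N; rewrite lprod_scal_l, lprod_scal_r, Hk; field; lra.
  - unfold N; rewrite lprod_scal_r.
    assert (E : ds (fun _ _ => 1) s t = 0) by exact (Derive_const 1 s).
    rewrite (ds_lprod I J hI T T) in E; auto;
      [|intros u v Iu Jv; symmetry; now apply Hunit].
    rewrite (lprod_sym (Ds T s t)) in E.
    replace (lprod (T s t) (Ds T s t)) with 0 by lra; ring. }
assert (SB : vsmooth_on I J B) by now apply vsmooth_on_lcross.
assert (M := moving_frame_lcross I J hI hJ T N ST SN HT); fold B in M; simpl in M.
set (tau := fun s t => lprod (Ds N s t) (B s t)) in M.
set (nu := fun s t => lprod (Dt N s t) (B s t)) in M.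
assert (HTt : forall s t, I s -> J t ->
  Dt T s t = plus (scal (kap s t * tau s t) (N s t)) (scal (ds kap s t) (B s t))).
{ intros s t Is Jt; unfold T at 1; rewrite (tangent_evolution I J hI hJ) by assumption.
  fold T; rewrite (Ds_ext I J hI (Ds T) (fun s t => scal (kap s t) (N s t))) by assumption.
  assert (D : Ds (fun s t => scal (kap s t) (N s t)) s t = _)
    by exact (is_vderive_unique _ _ _ (is_vderive_scal _ _ _ _ _
       (smooth_on_is_derive_s I J kap s t Skap Is Jt) (vsmooth_on_is_vderive_s I J N s t SN Is Jt))).
  rewrite D; destruct M as [_ M]; destruct (M s t Is Jt) as [_ [[_ [-> _]] _]].
  destruct (HT s t Is Jt) as [TT [NN TN]].
  transitivity (plus (scal (kap s t * tau s t) (lcross (T s t) (B s t)))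
    (scal (ds kap s t) (B s t))).
  - fold (tau s t); unfold B; generalize (T s t) (N s t); clear; intros; vector_ring.
  - unfold B; rewrite lcross_lcross_l, TT, TN.
    generalize (T s t) (N s t); clear; intros; vector_ring. }
exists N, B, kap, tau, nu; split; [split; [|split]|].
- assumption.
- apply smooth_on_lprod; auto using vsmooth_on_Ds.
- apply smooth_on_lprod; auto using vsmooth_on_Dt.
- assert (O : forall s t, I s -> J t -> orthonormal (T s t) (N s t) (B s t))
    by (intros; now apply M).
  apply (moving_frame_ext _ _ _ _ _ _ _ _ _ _ _ _ _ _ _ M); intros s t Is Jt;
    try reflexivity; destruct (O s t Is Jt) as [TT [NN [BB [TN [TB NB]]]]].
  + rewrite HTs, lprod_scal_l, NN by assumption; ring.
  + rewrite HTs, lprod_scal_l, NB by assumption; ring.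
  + rewrite HTt, lprod_plus_l, !lprod_scal_l, NN, (lprod_sym (B s t)), NB by assumption; ring.
  + rewrite HTt, lprod_plus_l, !lprod_scal_l, BB, NB by assumption; ring.
Qed.

Lemma parallel_frame_of_moving_frame (alpha E1 E2 : R -> R -> E13) (k1 k2 : R -> R -> R) :
  smooth_on I J k1 -> smooth_on I J k2 ->
  moving_frame I J (Ds alpha) E1 E2 k1 k2 (fun _ _ => 0) (ds k2) (ds k1)
    (fun s t => 1 / 2 * (k1 s t ^ 2 - k2 s t ^ 2)) ->
  vortex_parallel_frame I J alpha E1 E2 k1 k2.
Proof.
intros S1 S2 [[_ [SE1 SE2]] M].
repeat (split; [assumption|]); split; [|split].
- intros t Jt; split; intros s Is; destruct (M s t Is Jt) as [[TT [NN [BB [TN [TB NB]]]]] [[HT [HN HB]] _]].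
  + repeat split; try assumption.
    * change (vderive (fun u => E1 u t) s) with (Ds E1 s t).
      rewrite HN, lprod_lincomb_l, TB; ring.
    * change (vderive (fun u => E2 u t) s) with (Ds E2 s t).
      rewrite HB, lprod_lincomb_r, (lprod_sym (E1 s t)), TN; ring.
  + change (vderive (vderive (fun u => alpha u t)) s) with (Ds (Ds alpha) s t).
    rewrite HT; generalize (Ds alpha s t) (E1 s t) (E2 s t); clear; intros; vector_ring.
- intros s t Is Jt; apply (M s t Is Jt).
- intros s t Is Jt; apply (M s t Is Jt).
Qed.

(** The Frenet frame has to be boosted by an angle with [th_s = - tau], for
    the frame to be parallel, and [th_t = kap^2 / 2 - nu], for the normal
    rotation rate in [t] to be [(k1^2 - k2^2) / 2].  The zero curvature
    equation [nu_s - tau_t = kap * kap_s] says that this system is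
    integrable. *)
Lemma exists_vortex_parallel_frame (alpha : R -> R -> E13) :
  vsmooth_on I J alpha -> vortex_filament I J alpha ->
  (forall t, J t -> timelike_principal_normal I (fun s => alpha s t)) ->
  (forall s t, I s -> J t -> lprod (Ds alpha s t) (Ds alpha s t) = 1) ->
  exists (E1 E2 : R -> R -> E13) (k1 k2 : R -> R -> R),
    vortex_parallel_frame I J alpha E1 E2 k1 k2.
Proof.
intros Sa V HN Hunit.
destruct (frenet_moving_frame alpha Sa V HN Hunit) as [N [B [kap [tau [nu [[Sk [St Sn]] M]]]]]].
destruct (smooth_on_potential I J hI hJ (fun s t => - tau s t)
  (fun s t => / 2 * (kap s t * kap s t) + - nu s t)) as [th [Sth Dth]].
- now apply smooth_on_opp.
- apply smooth_on_plus; auto; [|now apply smooth_on_opp].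
  apply smooth_on_mult; auto using smooth_on_const, smooth_on_mult.
- intros s t Is Jt.
  destruct (moving_frame_compatibility I J hI hJ _ _ _ _ _ _ _ _ _ s t M Is Jt) as [_ [_ C]].
  transitivity (- dt tau s t).
  { apply is_derive_unique, @is_derive_opp; now apply (smooth_on_is_derive_t I J). }
  symmetry; transitivity
    (/ 2 * (ds kap s t * kap s t + kap s t * ds kap s t) + - ds nu s t); [|lra].
  apply is_derive_unique, @is_derive_plus; [|apply @is_derive_opp];
    [apply is_derive_scal, (Derive.is_derive_mult (fun u => kap u t) (fun u => kap u t)) |];
    now apply (smooth_on_is_derive_s I J).
- set (k1 := fun s t => kap s t * cosh (th s t)).
  set (k2 := fun s t => - (kap s t * sinh (th s t))).
  assert (S1 : smooth_on I J k1) by (apply smooth_on_mult; auto using smooth_on_cosh).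
  assert (S2 : smooth_on I J k2)
    by (apply smooth_on_opp; auto; apply smooth_on_mult; auto using smooth_on_sinh).
  assert (D1 : forall s t, I s -> J t ->
    ds k1 s t = ds kap s t * cosh (th s t) + kap s t * (- tau s t * sinh (th s t))).
  { intros s t Is Jt; apply is_derive_unique.
    apply (Derive.is_derive_mult (fun u => kap u t) (fun u => cosh (th u t))).
    - now apply (smooth_on_is_derive_s I J).
    - exact (is_derive_comp cosh (fun u => th u t) s _ _ (is_derive_cosh (th s t))
        (proj1 (proj2 (Dth s t Is Jt)))). }
  assert (D2 : forall s t, I s -> J t ->
    ds k2 s t = - (ds kap s t * sinh (th s t) + kap s t * (- tau s t * cosh (th s t)))).
  { intros s t Is Jt; apply is_derive_unique, @is_derive_opp.
    apply (Derive.is_derive_mult (fun u => kap u t) (fun u => sinh (th u t))).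
    - now apply (smooth_on_is_derive_s I J).
    - exact (is_derive_comp sinh (fun u => th u t) s _ _ (is_derive_sinh (th s t))
        (proj1 (proj2 (Dth s t Is Jt)))). }
  exists (fun s t => boost1 (th s t) (N s t) (B s t)),
    (fun s t => boost2 (th s t) (N s t) (B s t)), k1, k2.
  apply parallel_frame_of_moving_frame; auto.
  assert (M' := moving_frame_boost I J hI hJ _ _ _ _ _ _ _ _ _ th _ _ M Dth Sth).
  apply (moving_frame_ext _ _ _ _ _ _ _ _ _ _ _ _ _ _ _ M'); intros s t Is Jt;
    rewrite ?D1, ?D2 by assumption; unfold k1, k2.
  + ring.
  + ring.
  + ring.
  + ring.
  + ring.
  + replace (/ 2 * (kap s t * kap s t)) with
      (/ 2 * (kap s t * kap s t) * (cosh (th s t) ^ 2 - sinh (th s t) ^ 2))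
      by (rewrite cosh2_sinh2; ring).
    field.
Qed.

End Main.

Theorem theorem3p4 (I J : R -> Prop) (alpha : R -> R -> E13)
    (hI : is_open_interval I) (hJ : is_open_interval J) (hJ0 : J 0)
    (hsmooth : vsmooth_on I J alpha)
    (hvfe : vortex_filament I J alpha)
    (hspace : forall t, J t -> spacelike_curve I (fun s => alpha s t))
    (hnormal : forall t, J t -> timelike_principal_normal I (fun s => alpha s t))
    (hunit : forall s, I s -> lnorm (Ds alpha s 0) = 1) :
  (exists (E1 E2 : R -> R -> E13) (k1 k2 : R -> R -> R),
     vortex_parallel_frame I J alpha E1 E2 k1 k2) /\
  (forall (E1 E2 : R -> R -> E13) (k1 k2 : R -> R -> R),
     vortex_parallel_frame I J alpha E1 E2 k1 k2 ->
     nonlinear_heat_system I J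
       (fun s t => 1 / sqrt 2 * (k1 s t + k2 s t))
       (fun s t => - (1 / sqrt 2) * (k1 s t - k2 s t))).
Proof.
split.
- apply exists_vortex_parallel_frame; auto.
  intros s t Is Jt; apply (unit_tangent I J hI hJ); auto.
  assert (Hp : 0 < lprod (Ds alpha s 0) (Ds alpha s 0)) by exact (hspace 0 hJ0 s Is).
  assert (Hn := hunit s Is); unfold lnorm in Hn; rewrite Rabs_pos_eq in Hn by lra.
  rewrite <- (sqrt_sqrt (lprod (Ds alpha s 0) (Ds alpha s 0))), Hn by lra; ring.
- intros E1 E2 k1 k2; now apply heat_system_of_parallel_frame.
Qed.
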